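(* Let $\Lambda$ be a full rank lattice of $\mathbb{R}^d$ containing $\mathbb{Z}^d$. Then for any finite set of data $\mathcal{F}=\{f_1,\dots,f_m\}\subset L^2(\mathbb{R}^d)$ and any positive integer $\ell$, $$\mathcal{E}^*(\mathcal{F},\Lambda,\ell)\le\mathcal{E}^*(\mathcal{F},\mathbb{Z}^d,\ell).$$
   Context: For a full rank lattice $\Lambda$ and a family $\Psi\subset L^2(\mathbb{R}^d)$, $S_\Lambda(\Psi)=\overline{\mathrm{span}}\{\psi(\cdot-\lambda):\lambda\in\Lambda,\psi\in\Psi\}$. For a closed subspace $W$ with orthogonal projection $\mathbb{P}_W$, $\mathcal{E}(\mathcal{F},W)=\sum_{i=1}^m\|f_i-\mathbb{P}_Wf_i\|^2$. $\mathcal{E}^*(\mathcal{F},\Lambda,\ell)$ is the minimum of $\mathcal{E}(\mathcal{F},S)$ over all $\Lambda$-invariant subspaces $S$ with at most $\ell$ generators, i.e. $S=S_\Lambda(\{\psi_1,\dots,\psi_\ell\})$ with $\psi_j\in L^2(\mathbb{R}^d)$ (the minimum is known to be attained). *)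

(* Defs.v *)
From HB Require Import structures.
From mathcomp Require Import all_boot all_order all_algebra.
From mathcomp Require Import all_classical all_reals all_analysis.
From mathcomp Require Import complex.

Set Implicit Arguments.
Unset Strict Implicit.
Unset Printing Implicit Defensive.

Import Order.TTheory GRing.Theory Num.Theory.
Import numFieldNormedType.Exports.

Local Open Scope classical_set_scope.
Local Open Scope ring_scope.

(* R^n is 'rV[R]_n with the sigma-algebra generated by the coordinates, i.e.
   the product, hence the Borel, sigma-algebra. *)
Section measurable_rV.
Context (R : realType) (n : nat).
Let coors (i : 'I_n) (v : 'rV[R]_n) : R := v 0 i.

Let rV_set0 : g_sigma_preimage coors set0.
Proof. exact: sigma_algebra0. Qed.

Let rV_setC A : g_sigma_preimage coors A -> g_sigma_preimage coors (~` A).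
Proof. exact: sigma_algebraC. Qed.

Let rV_bigcup (F : (set 'rV[R]_n)^nat) :
  (forall i, g_sigma_preimage coors (F i)) ->
  g_sigma_preimage coors (\bigcup_i (F i)).
Proof. exact: sigma_algebra_bigcup. Qed.

HB.instance Definition _ :=
  @isMeasurable.Build (measure_tuple_display default_measure_display)
    'rV[R]_n (g_sigma_preimage coors) rV_set0 rV_setC rV_bigcup.

End measurable_rV.

Lemma measurable_rV_coor (R : realType) n (i : 'I_n) :
  measurable_fun [set: 'rV[R]_n] (fun v => v 0 i : R).
Proof.
move=> _ Y mY; rewrite setTI; apply: sub_sigma_algebra => /=.
rewrite -bigcup_seq/=; exists i => /=; first by rewrite mem_index_enum.
by exists Y => //; rewrite setTI.
Qed.

Lemma measurable_rV_box (R : realType) n (A : 'I_n -> set R) :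
  (forall i, measurable (A i)) ->
  measurable [set v : 'rV[R]_n | forall i, A i (v 0 i)].
Proof.
move=> mA.
rewrite (_ : [set _ | _] =
    \bigcap_(i in setT) ((fun v : 'rV[R]_n => v 0 i : R) @^-1` A i)); last first.
  by apply/seteqP; split => v h i; [move=> _; exact: h|exact: (h i I)].
apply: fin_bigcap_measurable => [|i _]; first exact: finite_finset.
by rewrite -[X in measurable X]setTI; exact: measurable_rV_coor.
Qed.

Lemma measurable_fun_rVP d (T : measurableType d) (R : realType) n
    (f : T -> 'rV[R]_n) :
  (forall i, measurable_fun [set: T] (fun x => f x 0 i : R)) ->
  measurable_fun [set: T] f.
Proof.
move=> mf.
have H : g_sigma_preimage (fun i x => f x 0 i : R) `<=` measurable.
  apply: smallest_sub; first exact: sigma_algebra_measurable.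
  case: n => [|n] in f mf *; first by rewrite big_ord0.
  rewrite -bigcup_mkord_ord; apply: bigcup_sub => i Ii.
  by move=> A [B mB <-]; exact: mf.
move=> _ A mA; apply: H.
rewrite (_ : (fun i x => _) = (fun i => (fun v : 'rV[R]_n => v 0 i : R) \o f))//.
by rewrite g_sigma_preimage_comp; exists A.
Qed.

Section lebesgue_rV.
Context (R : realType).

Definition cons_rV n (p : R * 'rV[R]_n) : 'rV[R]_n.+1 := row_mx p.1%:M p.2.

Lemma cons_rV0 n (p : R * 'rV[R]_n) : cons_rV p 0 0 = p.1.
Proof.
rewrite /cons_rV (_ : (0 : 'I_n.+1) = lshift n (0 : 'I_1));
  last exact/val_inj.
by rewrite (@row_mxEl _ 1 1 n) mxE eqxx mulr1n.
Qed.

Lemma cons_rVS n (p : R * 'rV[R]_n) i : cons_rV p 0 (lift ord0 i) = p.2 0 i.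
Proof.
rewrite /cons_rV (_ : lift ord0 i = rshift 1 i); last exact/val_inj.
by rewrite (@row_mxEr _ 1 1 n).
Qed.

Lemma measurable_cons_rV n : measurable_fun [set: R * 'rV[R]_n] (@cons_rV n).
Proof.
apply: measurable_fun_rVP => i.
have [->|[j ->]] : i = ord0 \/ exists j, i = lift ord0 j.
  by case: (unliftP ord0 i) => [j ->|->]; [right; exists j|left].
- under eq_fun do rewrite cons_rV0.
  exact: measurable_fst.
- under eq_fun do rewrite cons_rVS.
  by apply: measurableT_comp (measurable_rV_coor j) measurable_snd.
Qed.

(* Lebesgue measure on the Borel sets of R^n: the n-fold product of the
   one-dimensional Lebesgue measure. *)
Fixpoint lebesgue_rV n : set 'rV[R]_n -> \bar R :=
  match n with
  | 0 => \d_(0 : 'rV[R]_0)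
  | n'.+1 => pushforward (@lebesgue_measure R \x^ @lebesgue_rV n')%E
               (@cons_rV n')
  end.

Let lebesgue_rV_measure n :
  exists mu : {measure set 'rV[R]_n -> \bar R}, mu = @lebesgue_rV n :> (_ -> _).
Proof.
elim: n => [|n [mu muE]] /=; first by eexists.
rewrite -muE.
unshelve eexists (pushforward (@lebesgue_measure R \x^ mu)%E (@cons_rV n)
  : {measure set _ -> \bar R}) => //.
exact: measurable_cons_rV.
Qed.

Section lebesgue_rV_is_measure.
Context (n : nat).

Let lebesgue_rV0 : lebesgue_rV (set0 : set 'rV[R]_n) = 0%E.
Proof. by have [mu <-] := lebesgue_rV_measure n; rewrite measure0. Qed.

Let lebesgue_rV_ge0 (A : set 'rV[R]_n) : (0 <= lebesgue_rV A)%E.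
Proof. by have [mu <-] := lebesgue_rV_measure n. Qed.

Let lebesgue_rV_sigma_additive : semi_sigma_additive (@lebesgue_rV n).
Proof.
by have [mu <-] := lebesgue_rV_measure n; exact: measure_semi_sigma_additive.
Qed.

HB.instance Definition _ := isMeasure.Build _ _ _ (@lebesgue_rV n)
  lebesgue_rV0 lebesgue_rV_ge0 lebesgue_rV_sigma_additive.

End lebesgue_rV_is_measure.

Lemma lebesgue_rV_box n (A : 'I_n -> set R) :
  (forall i, measurable (A i)) ->
  lebesgue_rV [set v : 'rV[R]_n | forall i, A i (v 0 i)] =
  (\prod_(i < n) lebesgue_measure (A i))%E.
Proof.
elim: n => [|n IH] in A *.
  move=> _; rewrite big_ord0 /= diracE mem_set//.
  by case.
move=> mA; rewrite big_ord_recl /= /pushforward.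
rewrite (_ : _ @^-1` _ =
    A ord0 `*` [set v : 'rV[R]_n | forall i, A (lift ord0 i) (v 0 i)]).
  rewrite product_measure2E; [|exact: mA|].
    by rewrite [X in (_ * X)%E](IH (fun i => A (lift ord0 i))).
  exact: (@measurable_rV_box R n (fun i => A (lift ord0 i))).
apply/seteqP; split => [[x v]/= h|[x v] /= [h0 h] i].
  split; first by have := h ord0; rewrite cons_rV0.
  by move=> i; have := h (lift ord0 i); rewrite cons_rVS.
by case: (unliftP ord0 i) => [j ->|->]; rewrite ?cons_rVS ?cons_rV0.
Qed.

End lebesgue_rV.

Section L2.
Context (R : realType) (d : nat).
Local Notation mu := (@lebesgue_rV R d).
Implicit Types (f g h : 'rV[R]_d -> R[i]) (G W : set ('rV[R]_d -> R[i])).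

(* Elements of the complex Hilbert space L^2(R^d) are represented by functions; no quotient by almost
   everywhere equality is taken, and all the sets closed_span G below are
   saturated for it. *)
Definition L2 : set ('rV[R]_d -> R[i]) :=
  [set f | (fun x => complex.Re (f x)) \in Lfun mu 2%:E /\
           (fun x => complex.Im (f x)) \in Lfun mu 2%:E].

Definition Cintegral f : R[i] :=
  Complex (\int[mu]_x complex.Re (f x)) (\int[mu]_x complex.Im (f x)).

Definition inner f g : R[i] := Cintegral (fun x => f x * (g x)^*).

Definition L2norm f : R := Num.sqrt (complex.Re (inner f f)).

Definition lin_span G : set ('rV[R]_d -> R[i]) :=
  [set h | exists n (c : 'I_n -> R[i]) (u : 'I_n -> 'rV[R]_d -> R[i]),
    (forall i, G (u i)) /\ h = fun x => \sum_(i < n) c i * u i x].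

Definition closed_span G : set ('rV[R]_d -> R[i]) :=
  [set f | L2 f /\
    forall e : R, 0 < e -> exists2 h, lin_span G h & L2norm (f \- h) < e].

Definition is_orth_proj W f g := W g /\ forall h, W h -> inner (f \- g) h = 0.

(* For f in L^2 and W a closed subspace, such a g exists and is unique up to
   almost everywhere equality, so that the errors below do not depend on the
   representative chosen. *)
Definition orth_proj W f := xget 0 (is_orth_proj W f).

Definition translate (a : 'rV[R]_d) f : 'rV[R]_d -> R[i] := fun x => f (x - a).

Definition shift_space (Lam : set 'rV[R]_d) G :=
  closed_span [set translate a g | a in Lam & g in G].

Definition approx_error m (F : 'I_m -> 'rV[R]_d -> R[i]) W : R :=
  \sum_(i < m) L2norm (F i \- orth_proj W (F i)) ^+ 2.

Definition approx_errors m (F : 'I_m -> 'rV[R]_d -> R[i]) Lam l : set R :=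
  [set approx_error F (shift_space Lam (range psi)) |
    psi in [set psi : 'I_l -> 'rV[R]_d -> R[i] | forall j, L2 (psi j)]].

(* The minimum is rendered by the infimum in R (of a nonempty set of
   nonnegative reals), with which it coincides when it is attained. *)
Definition optimal_error m (F : 'I_m -> 'rV[R]_d -> R[i]) Lam l : R :=
  inf (approx_errors F Lam l).

Lemma optimal_error_min m (F : 'I_m -> 'rV[R]_d -> R[i]) Lam l e :
  approx_errors F Lam l e -> lbound (approx_errors F Lam l) e ->
  optimal_error F Lam l = e.
Proof.
move=> Ee lbe; apply/eqP; rewrite eq_le; apply/andP; split.
  by apply: ge_inf => //; exists e.
by apply: lb_le_inf => //; exists e.
Qed.

Definition Zlattice : set 'rV[R]_d := [set k | forall i, k 0 i \is a Num.int].

(* The rows of A form a basis of the lattice. *)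
Definition full_rank_lattice (Lam : set 'rV[R]_d) :=
  exists2 A : 'M[R]_d, A \in unitmx & Lam = [set k *m A | k in Zlattice].

End L2.

Arguments Zlattice : clear implicits.

(* Main.v *)
Require Import Defs.
From mathcomp Require Import all_boot all_order all_algebra.
From mathcomp Require Import all_classical all_reals all_analysis.
From mathcomp Require Import complex.
From mathcomp Require Import measurable_realfun ring lra.

(** The same generators do at least as well for the larger lattice: as
[Zlattice] is contained in [Lam], the closed span of the [Zlattice]-translates
of a family [psi] is contained in the closed span of its [Lam]-translates, and
the distance from a function to a closed subspace can only decrease when the
subspace grows.  So each error achieved with [Zlattice] is at least the one
achieved by the same [psi] with [Lam], and the infima compare.

The substance is in the sentence on distances.  The error of a space [W] is
measured at the point chosen by [orth_proj], which is meaningful only where an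
orthogonal projection exists.  This is the Hilbert projection theorem
([ex_orth_proj], [orth_proj_min]) for the closed span of a subset of L^2.
Two facts about L^2 are needed for it:
- completeness ([L2_complete]): a sequence that is Cauchy at a geometric rate
  converges almost everywhere ([fast_cauchy_ae_cvg]), and Fatou's lemma
  ([fatou_le]) carries bounds on distances over to the limit;
- translates of square-integrable functions are square-integrable
  ([L2_translate]), so that the theorem applies to the spans at hand; indeed
  Lebesgue measure is invariant under translation ([lebesgue_rV_translate], by
  induction on the dimension).

The Hilbert space argument only uses the real inner product [re_inner], the
real part of [inner]; complex orthogonality follows from the real one since a
closed span is stable under multiplication by the imaginary unit. *)

Set Implicit Arguments.
Unset Strict Implicit.
Unset Printing Implicit Defensive.

Import Order.TTheory GRing.Theory Num.Theory.
Import numFieldNormedType.Exports.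

Local Open Scope classical_set_scope.
Local Open Scope ring_scope.

(** * Square-integrable functions on a measure space *)

Section square_integrable.
Context d (T : measurableType d) (R : realType).
Context (mu : {measure set T -> \bar R}).
Implicit Types (f g : T -> R).

Lemma Lfun2P f : f \in Lfun mu 2%:E <->
  measurable_fun setT f /\ (\int[mu]_x (f x ^+ 2)%:E < +oo)%E.
Proof.
split=> [f2|[mf f2]].
  have /Lfun2_integrable_sqr/integrableP[_] := f2.
  move: f2; rewrite inE => /andP[/[!inE]/= mf _] ifoo; split => //.
  apply: le_lt_trans ifoo; apply: ge0_le_integral => //=.
  - by move=> x _; rewrite lee_fin sqr_ge0.
  - by apply/measurable_EFinP; exact: measurable_funX.
  - do 2 apply: measurableT_comp => //; exact: measurable_funX.
  - by move=> x _; rewrite lee_fin ler_norm.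
rewrite inE; apply/andP; split; rewrite inE//=.
rewrite /finite_norm unlock poweR_lty//.
under eq_integral do rewrite /= powR_mulrn// real_normK ?num_real//.
by [].
Qed.

(** Fatou's lemma, when the lower limit is an almost everywhere limit. *)
Lemma fatou_le (phi : (T -> R)^nat) (psi : T -> R) (C : \bar R) :
  (forall n, measurable_fun setT (phi n)) -> measurable_fun setT psi ->
  (forall n x, 0 <= phi n x) -> (forall x, 0 <= psi x) ->
  {ae mu, forall x, phi n x @[n --> \oo] --> psi x} ->
  (forall n, (\int[mu]_x (phi n x)%:E <= C)%E) ->
  (\int[mu]_x (psi x)%:E <= C)%E.
Proof.
move=> mphi mpsi phi0 psi0 cv le_C.
have mphiE n : measurable_fun setT (fun x => (phi n x)%:E).
  exact/measurable_EFinP.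
have phiE0 n x : setT x -> (0 <= (phi n x)%:E)%E by rewrite lee_fin.
have -> : (\int[mu]_x (psi x)%:E =
    \int[mu]_x limn_einf (fun n => (phi n x)%:E))%E.
  apply: ge0_ae_eq_integral => //.
  - exact/measurable_EFinP.
  - apply: measurableT_comp => //; apply: measurable_fun_limn_esup => n.
    exact: measurableT_comp.
  - by move=> x _; rewrite lee_fin.
  - move=> x _; rewrite limn_einf_lim; apply: lime_ge.
      exact: is_cvg_einfs.
    by apply: nearW => n; apply: le_ereal_inf_tmp => _ [m _ <-]; rewrite lee_fin.
  - apply: filterS cv => x cvx _.
    apply/esym/(cvg_limn_einf_sup _).1.
    by apply/cvg_EFin => //; exact: nearW.
apply: (le_trans (fatou mu measurableT mphiE phiE0)).
apply: (le_trans (limn_einf_sup _)); rewrite limn_esup_lim.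
apply: lime_le; first exact: is_cvg_esups.
apply: nearW => n; apply: ge_ereal_sup => _ [m _ <-]; exact: le_C.
Qed.

(** The series of terms [2 ^+ n * (u n.+1 - u n) ^+ 2] has a finite
integral, hence a finite sum almost everywhere.  At such a point the increments
of [u] are absolutely summable, since [`|b| <= 2 ^- n + 2 ^+ n * b ^+ 2] for all
real [b]. *)
Lemma fast_cauchy_ae_cvg (u : (T -> R)^nat) :
  (forall n, measurable_fun setT (u n)) ->
  (forall n, (\int[mu]_x ((u n.+1 x - u n x) ^+ 2)%:E <= (4 ^- n)%:E)%E) ->
  exists2 v : T -> R, measurable_fun setT v &
    {ae mu, forall x, u n x @[n --> \oo] --> v x}.
Proof.
move=> mu_ le_u.
pose a n x := (2 ^+ n * (u n.+1 x - u n x) ^+ 2).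
have a0 n x : 0 <= a n x by rewrite mulr_ge0 ?sqr_ge0// exprn_ge0.
have ma n : measurable_fun setT (fun x => (a n x)%:E).
  apply/measurable_EFinP; apply: measurable_funM => //.
  by apply: measurable_funX; exact: measurable_funB.
have aE0 n x : setT x -> (0 <= (a n x)%:E)%E by rewrite lee_fin.
have le_a n : (\int[mu]_x (a n x)%:E <= (2 ^- n)%:E)%E.
  under eq_integral do rewrite EFinM.
  rewrite ge0_integralZl//; last 2 first.
  - by apply/measurable_EFinP; apply: measurable_funX; exact: measurable_funB.
  - by move=> x _; rewrite lee_fin sqr_ge0.
  apply: (@le_trans _ _ ((2 ^+ n)%:E * (4 ^- n)%:E)%E).
    by rewrite lee_pmul2l// ?lte_fin ?exprn_gt0.
  rewrite -EFinM lee_fin.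
  rewrite (_ : 4 = 2 * 2 :> R)%R; last by rewrite -natrM.
  by rewrite exprMn invfM mulrA divff ?mul1r// expf_neq0.
have fin_sum :
    {ae mu, forall x, setT x -> (\sum_(n <oo) (a n x)%:E)%E \is a fin_num}.
  apply: integrable_ae => //; apply/integrableP; split.
    by apply: ge0_emeasurable_sum => // n x _ _; exact: aE0.
  under eq_integral => x _.
    rewrite gee0_abs; last by apply: nneseries_ge0 => n _ _; exact: aE0.
  over.
  rewrite integral_nneseries//.
  apply: (@le_lt_trans _ _ (\sum_(n <oo) (2 ^- n)%:E)%E).
    by apply: lee_nneseries => [n _ _|n _];
      [apply: integral_ge0 => x _; exact: aE0|exact: le_a].
  apply: (@le_lt_trans _ _ 2%:E); last exact: ltry.
  apply: le_trans (epsilon_trick0 xpredT (ler0n R 2)).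
  apply: lee_nneseries => // n _.
  by rewrite lee_fin natrX exprS invfM mulrA divff// mul1r.
have cv : {ae mu, forall x, cvgn (fun n => u n x)}.
  apply: filterS fin_sum => x /(_ I) finx.
  have bounded_a n :
      \sum_(0 <= k < n) a k x <= fine (\sum_(k <oo) (a k x)%:E)%E.
    rewrite -lee_fin fineK// -sumEFin.
    by apply: nneseries_lim_ge => k _ _; exact: aE0.
  (* Multiplied by [2 ^+ n], this is [y <= 1 + y ^+ 2] for [y = 2 ^+ n * `|b|]. *)
  have le_diff n : `|u n.+1 x - u n x| <= 2^-1 ^+ n + a n x.
    rewrite /a; move: (u n.+1 x - u n x) => b; rewrite exprVn.
    have s0 : 0 < 2 ^+ n :> R by rewrite exprn_gt0.
    rewrite -(ler_pM2l s0) mulrDr divff ?gt_eqF//.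
    rewrite -[b ^+ 2]real_normK ?num_real//; set s := 2 ^+ n.
    have := sqr_ge0 (s * `|b| - 1); have := sqr_ge0 (s * `|b|); nra.
  have : cvgn (series (fun n => u n.+1 x - u n x)).
    apply: normed_cvg; apply: nondecreasing_is_cvgn.
      by apply: nondecreasing_series => n _ _ /=.
    exists (2 + fine (\sum_(k <oo) (a k x)%:E)%E) => _ [n _ <-] /=.
    apply: (le_trans (ler_sum _ (fun k _ => le_diff k))).
    rewrite big_split/= lerD//.
    have := @geometric_le_lim R n 1 2^-1 ler01 ltac:(lra).
    rewrite ger0_norm; last lra.
    move=> /(_ ltac:(lra)).
    rewrite /series/=; under eq_bigr do rewrite mul1r.
    have -> : 1 - 2^-1 = 2^-1 :> R by lra.
    by rewrite invrK mul1r.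
  move=> /cvg_ex[/= l ul]; apply/cvg_ex; exists (u 0 x + l).
  have -> : (fun n => u n x) =
      (fun n => u 0 x + series (fun n => u n.+1 x - u n x) n).
    by apply/funext => n; rewrite /series/= telescope_sumr// addrC subrK.
  by apply: cvgD => //; exact: cvg_cst.
(* The upper limit is measurable, whether or not the sequence converges. *)
exists (fun x => fine (limn_esup (fun n => (u n x)%:E))).
  apply/measurableT_comp => //.
  apply: measurable_fun_limn_esup => n.
  exact/measurable_EFinP.
apply: filterS cv => x /cvg_ex[/= l ul].
have /cvg_limn_einf_sup[_ ->]// : ((u n x)%:E @[n --> \oo] --> l%:E)%E.
by apply/cvg_EFin => //; exact: nearW.
Qed.
End square_integrable.

(** * Translation invariance of Lebesgue measure *)

Section translation.
Context (R : realType).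

Lemma lebesgue_measure_translate (a : R) (A : set R) : measurable A ->
  lebesgue_measure ((fun x => x - a) @^-1` A) = lebesgue_measure A.
Proof.
move=> mA; pose f (x : measurableTypeR R) : measurableTypeR R := x - a.
have mf : measurable_fun setT f by exact: measurable_funB.
apply/esym/(@lebesgue_measure_unique _ (pushforward lebesgue_measure f)) => //.
move=> X [[x y] _ <-] /=; rewrite /pushforward.
rewrite (_ : _ @^-1` _ = `]x + a, y + a]%classic); last first.
  by apply/seteqP; split => z /=; rewrite !in_itv/= ltrBrDr lerBlDr.
rewrite !lebesgue_measure_itv/= !lte_fin ltrD2r -!EFinB.
by rewrite opprD addrACA subrr addr0.
Qed.

Lemma measurable_translate n (a : 'rV[R]_n) :
  measurable_fun [set: 'rV[R]_n] (fun x => x - a).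
Proof.
apply: measurable_fun_rVP => i; under eq_fun do rewrite !mxE.
apply: measurable_funB => //; exact: measurable_rV_coor.
Qed.

(** By induction on the dimension: the measure of a translate is the integral of
the lengths of its one-dimensional sections.  Each of these is a translate of a
section of the original set over a translated point, so invariance on the line
removes the first shift and the induction hypothesis the other one. *)
Lemma lebesgue_rV_translate n (a : 'rV[R]_n) (A : set 'rV[R]_n) :
  measurable A -> lebesgue_rV ((fun x => x - a) @^-1` A) = lebesgue_rV A.
Proof.
elim: n => [|n IH] in a A *.
  move=> mA; congr lebesgue_rV; apply/seteqP.
  by split => x /=; rewrite [x - a]thinmx0 [x]thinmx0.
move=> mA; rewrite /= /pushforward /product_measure2.
pose a' : 'rV[R]_n := \row_i a 0 (lift ord0 i).
pose B := @cons_rV R n @^-1` A.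
have mB : measurable B.
  by rewrite -[B]setTI; exact: measurable_cons_rV.
pose phi := @lebesgue_measure R \o ysection B.
have mphi : measurable_fun setT phi by exact: measurable_fun_ysection.
pose T (v : 'rV[R]_n) : 'rV[R]_n := v - a'.
transitivity (\int[@lebesgue_rV R n]_v phi (T v))%E.
  apply: eq_integral => v _ /=.
  rewrite -[RHS](lebesgue_measure_translate (a 0 0)); last first.
    exact: measurable_ysection.
  congr (lebesgue_measure _); apply/seteqP.
  have E x : cons_rV (x, v) - a = cons_rV (x - a 0 0, v - a').
    apply/rowP => i; rewrite [LHS]mxE [(- a) _ _]mxE.
    by case: (unliftP ord0 i) => [j ->|->]; rewrite ?cons_rVS ?cons_rV0 /= ?mxE.
  by split => x /=; rewrite !/ysection /= !inE /B/= E.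
transitivity (\int[pushforward (@lebesgue_rV R n) T]_v (phi v))%E.
  by rewrite ge0_integral_pushforward//; exact: measurable_translate.
apply: eq_measure_integral => [|mT C mC _]; first exact: measurable_translate.
exact: IH.
Qed.

Lemma Lfun2_translate n (a : 'rV[R]_n) (f : 'rV[R]_n -> R) :
  f \in Lfun (@lebesgue_rV R n) 2%:E ->
  (fun x => f (x - a)) \in Lfun (@lebesgue_rV R n) 2%:E.
Proof.
move=> /Lfun2P[mf fin]; apply/Lfun2P; split.
  by apply: measurableT_comp => //; exact: measurable_translate.
apply: le_lt_trans fin.
pose T (v : 'rV[R]_n) : 'rV[R]_n := v - a.
rewrite le_eqVlt; apply/orP; left; apply/eqP.
transitivity (\int[pushforward (@lebesgue_rV R n) T]_v (f v ^+ 2)%:E)%E.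
  rewrite ge0_integral_pushforward//.
  - exact: measurable_translate.
  - by apply/measurable_EFinP; exact: measurable_funX.
  - by move=> x _; rewrite lee_fin sqr_ge0.
apply: eq_measure_integral => [|mT C mC _]; first exact: measurable_translate.
exact: (lebesgue_rV_translate a mC).
Qed.

End translation.

(** * The real Hilbert space structure of L^2 *)

Section hilbert.
Context (R : realType) (d : nat).
Local Notation mu := (@lebesgue_rV R d).
Implicit Types (f g h p q : 'rV[R]_d -> R[i]) (G : set ('rV[R]_d -> R[i])).

Definition re_inner f g : R := complex.Re (inner f g).
Definition sqnorm f : R := re_inner f f.

Lemma re_innerE f g : re_inner f g =
  \int[mu]_x (complex.Re (f x) * complex.Re (g x) +
              complex.Im (f x) * complex.Im (g x)).
Proof.
rewrite /re_inner /inner /=; apply: eq_Rintegral => x _.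
by case: (f x) (g x) => a b [a' b'] /=; rewrite mulrN opprK.
Qed.

(** Multiplication by the imaginary unit turns the imaginary part of the inner
product into a real part; this reduces complex to real orthogonality. *)
Lemma im_innerE f g : complex.Im (inner f g) = re_inner f (fun x => 'i%C * g x).
Proof.
rewrite re_innerE /inner /=; apply: eq_Rintegral => x _.
by case: (f x) (g x) => a b [a' b'] /=; ring.
Qed.

Lemma sqnormE f : sqnorm f =
  \int[mu]_x (complex.Re (f x) ^+ 2 + complex.Im (f x) ^+ 2).
Proof.
by rewrite /sqnorm re_innerE; apply: eq_Rintegral => x _; rewrite !expr2.
Qed.

Lemma sqnorm_ge0 f : 0 <= sqnorm f.
Proof.
by rewrite sqnormE; apply: Rintegral_ge0 => x _; rewrite addr_ge0 ?sqr_ge0.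
Qed.

Lemma L2norm_sqr f : L2norm f ^+ 2 = sqnorm f.
Proof. by rewrite sqr_sqrtr// sqnorm_ge0. Qed.

Lemma L2norm_lt f (e : R) : 0 < e -> (L2norm f < e) = (sqnorm f < e ^+ 2).
Proof.
by move=> e0; rewrite -L2norm_sqr ltr_pXn2r// ?nnegrE ?sqrtr_ge0// ltW.
Qed.

Lemma Lfun2_lin (a b : R) (u v : 'rV[R]_d -> R) :
  u \in Lfun mu 2%:E -> v \in Lfun mu 2%:E ->
  (fun x => a * u x + b * v x) \in Lfun mu 2%:E.
Proof.
have [L0 Llin] := @Lfun_submod_closed _ _ R mu 2%:E (lee1n 2).
move=> Lu Lv; apply: (Llin a u (fun x => b * v x)) => //.
have -> : (fun x => b * v x) = b *: v + 0 by rewrite addr0.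
exact: Llin.
Qed.

Lemma L2_lin (a b : R[i]) p q : L2 p -> L2 q -> L2 (fun x => a * p x + b * q x).
Proof.
move=> [Lrp Lip] [Lrq Liq].
case: a b => [a a'] [b b']; split.
  have -> : (fun x => complex.Re (Complex a a' * p x + Complex b b' * q x)) =
    (fun x => 1 * (a * complex.Re (p x) + (- a') * complex.Im (p x)) +
              1 * (b * complex.Re (q x) + (- b') * complex.Im (q x))).
    by apply/funext => x; case: (p x) (q x) => ? ? [? ?] /=; ring.
  by do 2 apply: Lfun2_lin => //; apply: Lfun2_lin.
have -> : (fun x => complex.Im (Complex a a' * p x + Complex b b' * q x)) =
    (fun x => 1 * (a * complex.Im (p x) + a' * complex.Re (p x)) +
              1 * (b * complex.Im (q x) + b' * complex.Re (q x))).
  by apply/funext => x; case: (p x) (q x) => ? ? [? ?] /=; ring.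
by do 2 apply: Lfun2_lin => //; apply: Lfun2_lin.
Qed.

Lemma L2_sub p q : L2 p -> L2 q -> L2 (p \- q).
Proof.
move=> Lp Lq; have := L2_lin 1 (-1) Lp Lq; congr L2.
by apply/funext => x; rewrite mul1r mulN1r.
Qed.

Lemma L2_scale a p : L2 p -> L2 (fun x => a * p x).
Proof.
move=> Lp; have := L2_lin a 0 Lp Lp; congr L2.
by apply/funext => x; rewrite mul0r addr0.
Qed.

Lemma L2_0 : L2 (0 : 'rV[R]_d -> R[i]).
Proof.
have [L0 _] := @Lfun_submod_closed _ _ R mu 2%:E (lee1n 2).
by split; exact: L0.
Qed.

Lemma L2_translate a f : L2 f -> L2 (translate a f).
Proof.
by move=> [/(Lfun2_translate a) Lr /(Lfun2_translate a) Li]; split.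
Qed.

Lemma integrable_mul (u v : 'rV[R]_d -> R) :
  u \in Lfun mu 2%:E -> v \in Lfun mu 2%:E ->
  mu.-integrable setT (EFin \o (fun x => u x * v x)).
Proof. by move=> Lu Lv; apply/Lfun1_integrable; exact: Lfun2_mul_Lfun1. Qed.

Lemma integrable_re_inner p q : L2 p -> L2 q ->
  mu.-integrable setT (EFin \o (fun x => complex.Re (p x) * complex.Re (q x) +
              complex.Im (p x) * complex.Im (q x))).
Proof.
move=> [Lrp Lip] [Lrq Liq].
have := integrableD measurableT
  (integrable_mul Lrp Lrq) (integrable_mul Lip Liq).
exact.
Qed.

Lemma sqnorm_fin f : L2 f ->
  (\int[mu]_x (complex.Re (f x) ^+ 2 + complex.Im (f x) ^+ 2)%:E =
    (sqnorm f)%:E)%E.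
Proof.
move=> Lf; rewrite sqnormE fineK//; apply: integrable_fin_num => //.
exact: (integrable_re_inner Lf Lf).
Qed.

(** The polarised expansion of the squared norm.  The parallelogram law, the
Pythagorean theorem and the variational inequality are all instances of it. *)
Lemma sqnorm_lin (s t : R) p q h : L2 p -> L2 q ->
  (forall x, h x = s%:C%C * p x + t%:C%C * q x) ->
  sqnorm h = s ^+ 2 * sqnorm p + 2 * s * t * re_inner p q + t ^+ 2 * sqnorm q.
Proof.
move=> Lp Lq hE; rewrite /sqnorm !re_innerE.
have ipp := integrable_re_inner Lp Lp.
have ipq := integrable_re_inner Lp Lq.
have iqq := integrable_re_inner Lq Lq.
have iZ c (u : 'rV[R]_d -> R) : mu.-integrable setT (EFin \o u) ->
    mu.-integrable setT (EFin \o (fun x => c * u x)).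
  by move=> iu; have := integrableZl measurableT c iu; exact.
have iD (u v : 'rV[R]_d -> R) : mu.-integrable setT (EFin \o u) ->
    mu.-integrable setT (EFin \o v) ->
    mu.-integrable setT (EFin \o (fun x => u x + v x)).
  by move=> iu iv; have := integrableD measurableT iu iv; exact.
rewrite -!RintegralZl// -!RintegralD//; try by [exact: iZ | apply: iD; exact: iZ].
apply: eq_Rintegral => x _; rewrite hE.
by case: (p x) (q x) => ? ? [? ?] /=; ring.
Qed.

Lemma sqnorm_i p : sqnorm (fun x => 'i%C * p x) = sqnorm p.
Proof.
rewrite !sqnormE; apply: eq_Rintegral => x _; by case: (p x) => ? ? /=; ring.
Qed.

Lemma sqnormC p q : sqnorm (p \- q) = sqnorm (q \- p).
Proof.
rewrite !sqnormE; apply: eq_Rintegral => x _ /=.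
by case: (p x) (q x) => ? ? [? ?] /=; ring.
Qed.

(** The parallelogram law without the squared norm of [s p - t q]. *)
Lemma sqnorm_lin_le (s t : R) p q h : L2 p -> L2 q ->
  (forall x, h x = s%:C%C * p x + t%:C%C * q x) ->
  sqnorm h <= 2 * (s ^+ 2 * sqnorm p + t ^+ 2 * sqnorm q).
Proof.
move=> Lp Lq hE; rewrite (sqnorm_lin Lp Lq hE).
have := sqnorm_ge0 (fun x => s%:C%C * p x + (- t)%:C%C * q x).
rewrite (@sqnorm_lin s (- t) p q)//; lra.
Qed.

End hilbert.

(** * Completeness of L^2 *)

Section completeness.
Context (R : realType) (d : nat).
Local Notation mu := (@lebesgue_rV R d).
Implicit Types (f g h p q : 'rV[R]_d -> R[i]) (G : set ('rV[R]_d -> R[i])).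

Lemma L2_measurable f : L2 f ->
  measurable_fun setT (fun x => complex.Re (f x)) /\
  measurable_fun setT (fun x => complex.Im (f x)).
Proof. by move=> [/Lfun2P[mr _] /Lfun2P[mi _]]. Qed.

Lemma L2_fin f : measurable_fun setT (fun x => complex.Re (f x)) ->
  measurable_fun setT (fun x => complex.Im (f x)) ->
  (\int[mu]_x (complex.Re (f x) ^+ 2 + complex.Im (f x) ^+ 2)%:E < +oo)%E ->
  L2 f.
Proof.
move=> mr mi fin; split; apply/Lfun2P; split=> //; apply: le_lt_trans fin;
  apply: ge0_le_integral => //=.
- by move=> x _; rewrite lee_fin sqr_ge0.
- by apply/measurable_EFinP; exact: measurable_funX.
- by apply/measurable_EFinP; apply: measurable_funD; exact: measurable_funX.
- by move=> x _; rewrite lee_fin lerDl sqr_ge0.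
- by move=> x _; rewrite lee_fin sqr_ge0.
- by apply/measurable_EFinP; exact: measurable_funX.
- by apply/measurable_EFinP; apply: measurable_funD; exact: measurable_funX.
- by move=> x _; rewrite lee_fin lerDr sqr_ge0.
Qed.

(** The limit is described by the bounds that it inherits: a bound on the
distance from [h] to all terms from some rank on also holds for the limit.  With
[h := w k] this gives convergence in norm; with [h] a point to be projected, it
shows that the limit of a minimising sequence attains the minimum. *)
Lemma L2_complete (w : nat -> 'rV[R]_d -> R[i]) :
  (forall n, L2 (w n)) ->
  (forall n m, (n <= m)%N -> sqnorm (w m \- w n) <= 4 ^- n) ->
  exists2 g, L2 g & forall h C k, L2 h ->
    (forall n, (k <= n)%N -> sqnorm (h \- w n) <= C) -> sqnorm (h \- g) <= C.
Proof.
move=> Lw cw.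
have Lcw n : (\int[mu]_x (complex.Re ((w n.+1 \- w n) x) ^+ 2 +
    complex.Im ((w n.+1 \- w n) x) ^+ 2)%:E <= (4 ^- n)%:E)%E.
  by rewrite sqnorm_fin ?lee_fin ?cw//; exact: L2_sub.
have ReB p q x : complex.Re ((p \- q) x) = complex.Re (p x) - complex.Re (q x).
  by move=> /=; case: (p x) (q x) => ? ? [].
have ImB p q x : complex.Im ((p \- q) x) = complex.Im (p x) - complex.Im (q x).
  by move=> /=; case: (p x) (q x) => ? ? [].
have msq p q :
    measurable_fun setT (fun x => complex.Re (p x)) ->
    measurable_fun setT (fun x => complex.Im (p x)) ->
    measurable_fun setT (fun x => complex.Re (q x)) ->
    measurable_fun setT (fun x => complex.Im (q x)) ->
    measurable_fun setT (fun x => complex.Re ((p \- q) x) ^+ 2 +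
                                  complex.Im ((p \- q) x) ^+ 2).
  move=> mrp mip mrq miq; under eq_fun do rewrite ReB ImB.
  by apply: measurable_funD; apply: measurable_funX; exact: measurable_funB.
have mLr n := (L2_measurable (Lw n)).1.
have mLi n := (L2_measurable (Lw n)).2.
(* Both coordinates are handled at once: [c] stands for the real or the
   imaginary part. *)
have part_cvg (c : R[i] -> R) : (forall y z, c (y - z) = c y - c z) ->
    (forall z, c z ^+ 2 <= complex.Re z ^+ 2 + complex.Im z ^+ 2) ->
    (forall n, measurable_fun setT (fun x => c (w n x))) ->
    exists2 v : 'rV[R]_d -> R, measurable_fun setT v &
      {ae mu, forall x, c (w n x) @[n --> \oo] --> v x}.
  move=> cB c_le mc; apply: fast_cauchy_ae_cvg => // n; apply: le_trans (Lcw n).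
  apply: ge0_le_integral => //=.
  - by move=> x _; rewrite lee_fin sqr_ge0.
  - by apply/measurable_EFinP; apply: measurable_funX; exact: measurable_funB.
  - by apply/measurable_EFinP; exact: msq.
  - by move=> x _; rewrite lee_fin -cB.
have [u mu_ ucv] : exists2 v : 'rV[R]_d -> R, measurable_fun setT v &
    {ae mu, forall x, complex.Re (w n x) @[n --> \oo] --> v x}.
  apply: part_cvg => // [[? ?] [? ?]//|z]; by rewrite lerDl sqr_ge0.
have [v mv vcv] : exists2 v : 'rV[R]_d -> R, measurable_fun setT v &
    {ae mu, forall x, complex.Im (w n x) @[n --> \oo] --> v x}.
  apply: part_cvg => // [[? ?] [? ?]//|z]; by rewrite lerDr sqr_ge0.
pose g x := Complex (u x) (v x).
have limit h C k : L2 h ->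
    (forall n, (k <= n)%N -> sqnorm (h \- w n) <= C) ->
    (\int[mu]_x (complex.Re ((h \- g) x) ^+ 2 + complex.Im ((h \- g) x) ^+ 2)%:E
      <= C%:E)%E.
  move=> Lh le_C; have [mhr mhi] := L2_measurable Lh.
  apply: (@fatou_le _ _ _ mu (fun n x => complex.Re ((h \- w (n + k)%N) x) ^+ 2 +
      complex.Im ((h \- w (n + k)%N) x) ^+ 2)).
  - by move=> n; exact: msq.
  - exact: msq.
  - by move=> n x; rewrite addr_ge0 ?sqr_ge0.
  - by move=> x; rewrite addr_ge0 ?sqr_ge0.
  - apply: filterS2 ucv vcv => x ux vx.
    under eq_fun do rewrite ReB ImB.
    rewrite ReB ImB /g /=.
    have sub_sqr_cvg (a l : R) (b : nat -> R) : b n @[n --> \oo] --> l ->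
        (a - b (n + k)%N) ^+ 2 @[n --> \oo] --> (a - l) ^+ 2.
      move=> bl; rewrite expr2; under eq_fun do rewrite expr2.
      have abl : a - b (n + k)%N @[n --> \oo] --> a - l.
        apply: cvgB; first exact: cvg_cst.
        by rewrite (cvg_shiftn k b).
      exact: (cvgM abl abl).
    apply: cvgD.
      exact: (sub_sqr_cvg _ _ (fun n => complex.Re (w n x))).
    exact: (sub_sqr_cvg _ _ (fun n => complex.Im (w n x))).
  - by move=> n; rewrite sqnorm_fin ?lee_fin ?le_C ?leq_addl//; exact: L2_sub.
(* Taking [h := w 0] shows that [w 0 - g], and so [g] itself, lies in L^2. *)
have Lg : L2 g.
  have Lg0 : L2 (w 0%N \- g).
    have [m0r m0i] := L2_measurable (Lw 0%N).
    apply: L2_fin.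
    - by under eq_fun do rewrite ReB; exact: measurable_funB.
    - by under eq_fun do rewrite ImB; exact: measurable_funB.
    apply: le_lt_trans (ltry (4 ^- 0)); apply: (limit _ _ 0%N) => // n n0.
    by rewrite sqnormC cw.
  have := L2_sub (Lw 0%N) Lg0; congr L2.
  by apply/funext => x /=; rewrite opprB addrC subrK.
exists g => // h C k Lh /(limit _ _ _ Lh).
by rewrite sqnorm_fin ?lee_fin//; exact: L2_sub.
Qed.
End completeness.

(** * Closed spans and the projection theorem *)

Section projection.
Context (R : realType) (d : nat).
Local Notation mu := (@lebesgue_rV R d).
Implicit Types (f g h p q : 'rV[R]_d -> R[i]) (G : set ('rV[R]_d -> R[i])).

Lemma lin_span0 G : lin_span G 0.
Proof.
exists 0%N, (fun=> 0), (fun=> 0); split; first by case.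
by apply/funext => x; rewrite big_ord0.
Qed.

Lemma lin_span_lin G (a b : R[i]) p q : lin_span G p -> lin_span G q ->
  lin_span G (fun x => a * p x + b * q x).
Proof.
move=> [n [c [u [Gu ->]]]] [m [e [v [Gv ->]]]].
exists (n + m)%N,
  (fun i : 'I_(n + m) =>
     match fintype.split i with inl j => a * c j | inr j => b * e j end),
  (fun i : 'I_(n + m) =>
     match fintype.split i with inl j => u j | inr j => v j end).
split=> [i|]; first by case: (fintype.split i).
apply/funext => x; rewrite big_split_ord/= !mulr_sumr.
by congr (_ + _); apply: eq_bigr => i _;
  rewrite ?(unsplitK (inl i)) ?(unsplitK (inr i)) mulrA.
Qed.

Lemma lin_span_mono G G' : G `<=` G' -> lin_span G `<=` lin_span G'.
Proof.
by move=> GG' h [n [c [u [Gu ->]]]]; exists n, c, u; split=> // i; exact: GG'.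
Qed.

Lemma closed_span_mono G G' : G `<=` G' -> closed_span G `<=` closed_span G'.
Proof.
move=> GG' f [Lf cf]; split=> // e /cf[h Gh fh].
by exists h => //; exact: lin_span_mono Gh.
Qed.

Section closed_span.
Context G (GL2 : G `<=` @L2 R d).

Lemma lin_span_L2 : lin_span G `<=` @L2 R d.
Proof.
move=> h [n [c [u [Gu ->]]]].
elim: n => [|n IH] in c u Gu *.
  have := @L2_0 R d; congr L2; by apply/funext => x; rewrite big_ord0.
have := L2_lin 1 (c ord0)
  (IH (c \o lift ord0) (u \o lift ord0) _) (GL2 (Gu ord0)).
move=> /(_ (fun i => Gu _)); congr L2.
by apply/funext => x; rewrite big_ord_recl /= mul1r addrC.
Qed.

Lemma closed_spanP f : closed_span G f <->
  L2 f /\ forall e : R, 0 < e -> exists2 h, lin_span G h & sqnorm (f \- h) < e.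
Proof.
split=> -[Lf cf]; split=> // e e0.
  have [|h Gh] := cf (Num.sqrt e); first by rewrite sqrtr_gt0.
  by rewrite L2norm_lt ?sqrtr_gt0// sqr_sqrtr ?ltW//; exists h.
have [|h Gh fh] := cf (e ^+ 2); first by rewrite exprn_gt0.
by exists h => //; rewrite L2norm_lt.
Qed.

Lemma closed_span_L2 : closed_span G `<=` @L2 R d.
Proof. by move=> f []. Qed.

Lemma closed_span0 : closed_span G 0.
Proof.
apply/closed_spanP; split; first exact: L2_0.
move=> e e0; exists 0; first exact: lin_span0.
rewrite (@sqnorm_lin _ _ 0 0 0 0) ?expr0n ?mulr0 ?mul0r ?addr0//; try exact: L2_0.
by move=> x; rewrite /= !mulr0 subr0 addr0.
Qed.

Lemma closed_span_lin (s t : R) p q : closed_span G p -> closed_span G q ->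
  closed_span G (fun x => s%:C%C * p x + t%:C%C * q x).
Proof.
move=> /closed_spanP[Lp cp] /closed_spanP[Lq cq]; apply/closed_spanP.
split=> [|e e0]; first exact: L2_lin.
(* The denominators make the two contributions less than [e / 2] each, also for
   zero coefficients. *)
have pos (r : R) : 0 < 4 * (r ^+ 2 + 1).
  by rewrite mulr_gt0// ltr_wpDl ?sqr_ge0.
have [|p' Gp' pp'] := cp (e / (4 * (s ^+ 2 + 1))); first by rewrite divr_gt0.
have [|q' Gq' qq'] := cq (e / (4 * (t ^+ 2 + 1))); first by rewrite divr_gt0.
exists (fun x => s%:C%C * p' x + t%:C%C * q' x); first exact: lin_span_lin.
have Lpp' := L2_sub Lp (lin_span_L2 Gp').
have Lqq' := L2_sub Lq (lin_span_L2 Gq').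
apply: le_lt_trans (@sqnorm_lin_le _ _ s t _ _ _ Lpp' Lqq' _) _.
  by move=> x /=; ring.
move: pp' qq'; rewrite !ltr_pdivlMr//.
have := sqnorm_ge0 (p \- p'); have := sqnorm_ge0 (q \- q').
have := sqr_ge0 s; have := sqr_ge0 t; nra.
Qed.

Lemma closed_span_sub p q : closed_span G p -> closed_span G q ->
  closed_span G (p \- q).
Proof.
move=> Wp Wq; have := closed_span_lin 1 (-1) Wp Wq; congr (closed_span G).
by apply/funext => x; rewrite rmorphN1 rmorph1 mul1r mulN1r.
Qed.

Lemma closed_span_i p : closed_span G p -> closed_span G (fun x => 'i%C * p x).
Proof.
move=> /closed_spanP[Lp cp]; apply/closed_spanP; split; first exact: L2_scale.
move=> e /cp[h Gh ph]; exists (fun x => 'i%C * h x).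
  have := lin_span_lin 'i%C 0 Gh Gh; congr (lin_span G).
  by apply/funext => x; rewrite mul0r addr0.
move: ph; rewrite -sqnorm_i; congr (sqnorm _ < _).
by apply/funext => x /=; ring.
Qed.

Lemma closed_span_lim g : L2 g ->
  (forall e : R, 0 < e -> exists2 w, closed_span G w & sqnorm (w \- g) < e) ->
  closed_span G g.
Proof.
move=> Lg cg; apply/closed_spanP; split=> // e e0.
have e4 : 0 < e / 4 by rewrite divr_gt0.
have [w /closed_spanP[Lw cw] wg] := cg _ e4.
have [h Gh wh] := cw _ e4; exists h => //.
have Lwh := L2_sub Lw (lin_span_L2 Gh).
apply: le_lt_trans (@sqnorm_lin_le _ _ (-1) 1 _ _ _ (L2_sub Lw Lg) Lwh _) _.
  by move=> x /=; rewrite rmorphN1 rmorph1; ring.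
by lra.
Qed.

(** A minimising sequence for the distance to [f] is Cauchy by the parallelogram
law; its limit attains the distance, and the variational inequality along lines
through the limit gives orthogonality. *)
Lemma ex_orth_proj f : L2 f -> exists g, is_orth_proj (closed_span G) f g.
Proof.
move=> Lf.
set W := closed_span G.
have WL := closed_span_L2.
pose S := [set sqnorm (f \- w) | w in W].
have hasS : has_inf S.
  split; first by exists (sqnorm (f \- 0)), 0 => //; exact: closed_span0.
  by exists 0 => _ [w _ <-]; exact: sqnorm_ge0.
pose del := inf S.
have del_le w : W w -> del <= sqnorm (f \- w).
  by move=> Ww; apply: ge_inf; [exact: hasS.2|exists w].
(* The parallelogram law bounds the squared distance between the terms [n <= m]
   of the minimising sequence by [2 * e n + 2 * e m <= 4 * e n = 4 ^- n]. *)
pose e n : R := 4 ^- n / 4.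
have e0 n : 0 < e n by rewrite divr_gt0// invr_gt0 exprn_gt0.
have e_small (r : R) : 0 < r -> exists n, 4 ^- n < r.
  move=> r0.
  have : (fun n => (4^-1) ^+ n : R) @ \oo --> (0 : R).
    by apply: cvg_expr; rewrite ger0_norm; lra.
  move=> /cvgrPdist_lt/(_ r r0)[n _ /(_ n (leqnn n))].
  rewrite sub0r normrN ger0_norm ?exprn_ge0 ?exprVn//; by exists n.
have e_mono n m : (n <= m)%N -> e m <= e n.
  move=> nm; rewrite ler_pM2r ?invr_gt0// lef_pV2 ?posrE ?exprn_gt0//.
  by rewrite ler_weXn2l//; lra.
have /choice[w wP] n : exists w, W w /\ sqnorm (f \- w) < del + e n.
  by have [_ [w Ww <-] lt] := inf_adherent (e0 n) hasS; exists w.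
have Ww n := (wP n).1.
have Lw n : L2 (w n) by exact/WL/Ww.
have cauchy n m : (n <= m)%N -> sqnorm (w m \- w n) <= 4 ^- n.
  move=> nm; have Ln := L2_sub Lf (Lw n); have Lm := L2_sub Lf (Lw m).
  rewrite (@sqnorm_lin _ _ 1 (-1) _ _ _ Ln Lm); last first.
    by move=> x /=; rewrite rmorphN1 rmorph1; ring.
  have := del_le _ (closed_span_lin 2^-1 2^-1 (Ww n) (Ww m)).
  rewrite (@sqnorm_lin _ _ 2^-1 2^-1 _ _ _ Ln Lm); last first.
    move=> x /=; rewrite -[f x in LHS]mul1r.
    rewrite (_ : 1 = 2^-1%:C%C + 2^-1%:C%C); last first.
      by apply/eqP; rewrite eq_complex/=; apply/andP; split; apply/eqP; lra.
    ring.
  have := (wP n).2; have := (wP m).2; have := e_mono _ _ nm; rewrite /e.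
  lra.
have [g Lg glim] := L2_complete Lw cauchy.
have Wg : W g.
  apply: closed_span_lim => // r /e_small[n nr]; exists (w n); first exact: Ww.
  apply: le_lt_trans nr; apply: (glim _ _ n) => // k nk.
  by rewrite sqnormC cauchy.
have g_min : sqnorm (f \- g) <= del.
  apply/ler_addgt0Pr => r /e_small[n nr].
  apply: (glim _ _ n) => // k nk; apply: le_trans (ltW (wP k).2) _.
  rewrite lerD2l; apply: le_trans (e_mono _ _ nk) _.
  by move: nr; rewrite /e; have := e0 n; rewrite /e; lra.
have re0 h : W h -> re_inner (f \- g) h = 0.
  move=> Wh; set r := re_inner _ _.
  have Lh := WL _ Wh; have Lfg := L2_sub Lf Lg.
  (* Moving from [g] to [g + t h] does not decrease the distance to [f]; the
     quadratic in [t] is minimal at [r / sqnorm h], where the denominator is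
     replaced below by [sqnorm h + 1] to avoid a division by zero. *)
  have quad t : 0 <= - 2 * t * r + t ^+ 2 * sqnorm h.
    have := del_le _ (closed_span_lin 1 t Wg Wh).
    rewrite (@sqnorm_lin _ _ 1 (- t) _ _ _ Lfg Lh); last first.
      by move=> x /=; rewrite rmorphN rmorph1; ring.
    by rewrite -/r; move: g_min; lra.
  have N0 := sqnorm_ge0 h.
  have N1 : 0 < sqnorm h + 1 by lra.
  have := quad (r / (sqnorm h + 1)).
  set N := sqnorm h in N0 N1 *; move=> Q.
  have : 0 <= (N + 1) ^+ 2 * (- 2 * (r / (N + 1)) * r + (r / (N + 1)) ^+ 2 * N).
    by rewrite mulr_ge0// sqr_ge0.
  have -> : (N + 1) ^+ 2 * (- 2 * (r / (N + 1)) * r + (r / (N + 1)) ^+ 2 * N) =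
      - (r ^+ 2 * (N + 2)).
    by field; rewrite gt_eqF.
  have := sqr_ge0 r; move=> r0 le0; apply/eqP.
  by rewrite -sqrf_eq0; apply/eqP; nra.
exists g; split=> // h Wh.
apply/eqP; rewrite eq_complex; apply/andP; split; apply/eqP.
  exact: re0.
by rewrite im_innerE; exact/re0/closed_span_i.
Qed.

(** Pythagoras: the residual is orthogonal to the difference of [w] and the
projection. *)
Lemma orth_proj_min f w : L2 f -> closed_span G w ->
  L2norm (f \- orth_proj (closed_span G) f) <= L2norm (f \- w).
Proof.
move=> Lf Ww.
have [g0 Pg0] := ex_orth_proj Lf.
have [] : is_orth_proj (closed_span G) f (orth_proj (closed_span G) f).
  exact: (xgetI _ Pg0).
set g := orth_proj _ _ => Wg orth.
rewrite -(@ler_pXn2r _ 2)// ?nnegrE ?sqrtr_ge0// !L2norm_sqr.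
have Lfg := L2_sub Lf (closed_span_L2 Wg).
have Lgw := L2_sub (closed_span_L2 Wg) (closed_span_L2 Ww).
rewrite [leRHS](@sqnorm_lin _ _ 1 1 _ _ _ Lfg Lgw); last first.
  by move=> x /=; rewrite rmorph1; ring.
rewrite /re_inner orth; last exact: closed_span_sub.
by have := sqnorm_ge0 (g \- w); rewrite /=; lra.
Qed.

End closed_span.
End projection.

(** * Comparison of the two lattices *)

Theorem mainTheorem9 (R : realType) (d m l : nat) (Lam : set 'rV[R]_d)
    (F : 'I_m -> 'rV[R]_d -> R[i]) :
  full_rank_lattice Lam -> Zlattice R d `<=` Lam ->
  (forall i, L2 (F i)) -> (0 < l)%N ->
  optimal_error F Lam l <= optimal_error F (Zlattice R d) l.
Proof.
move=> _ ZLam LF _.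
have err_ge0 W : 0 <= approx_error F W.
  by apply: sumr_ge0 => i _; exact: sqr_ge0.
apply: lb_le_inf.
  exists (approx_error F
    (shift_space (Zlattice R d) (range (fun _ : 'I_l => 0)))).
  by exists (fun=> 0) => // j; exact: L2_0.
move=> _ [psi Lpsi <-].
apply: (@le_trans _ _ (approx_error F (shift_space Lam (range psi)))).
  apply: ge_inf; last by exists psi.
  by exists 0 => _ [phi _ <-].
have sub :
    shift_space (Zlattice R d) (range psi) `<=` shift_space Lam (range psi).
  apply: closed_span_mono => _ [a Za [g Gg <-]].
  by exists a; [exact: ZLam|exists g].
have GL2 : [set translate a g | a in Lam & g in range psi] `<=` @L2 R d.
  by move=> _ [a _ [_ [j _ <-] <-]]; exact/L2_translate/Lpsi.
apply: ler_sum => i _; rewrite ler_pXn2r ?nnegrE ?sqrtr_ge0//.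
apply: orth_proj_min => //.
(* If the smaller space had no projection, the chosen point would be 0, which
   also lies in the larger space. *)
rewrite /orth_proj; case: xgetP => [g _ [/sub]|_]//.
exact: closed_span0.
Qed.
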